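(* (1) There exist a $\mathcal{W}$-positive set $X\subseteq\mathbb{Z}$ and a $\mathbb{Z}$-invariant colouring $c:[\mathbb{Z}]^2\to 2$ such that every $c$-homogeneous set $Y\subseteq X$ belongs to $\mathcal{W}$. (2) For every $k\geq 1$ there exist an $\mathcal{I}_{k\text{-}\mathsf{thin}}$-positive set $X\subseteq\mathbb{Z}$ and a $\mathbb{Z}$-invariant colouring $c:[\mathbb{Z}]^2\to 2$ such that every $c$-homogeneous set $Y\subseteq X$ belongs to $\mathcal{I}_{k\text{-}\mathsf{thin}}$.
   Context: $\mathcal{W}$ is the van der Waerden ideal on $\mathbb{Z}$: the family of all $A\subseteq\mathbb{Z}$ that do not contain arbitrarily long (finite) arithmetic progressions. For $k\geq 1$, a set $A\subseteq\mathbb{Z}$ is $k$-thin if $|(g+A)\cap A|\leq k$ for every $g\in\mathbb{Z}\setminus\{0\}$, and $\mathcal{I}_{k\text{-}\mathsf{thin}}$ is the ideal on $\mathbb{Z}$ consisting of all sets contained in a union of finitely many $k$-thin sets. For an ideal $\mathcal{I}$ on $\mathbb{Z}$, a set $X\subseteq\mathbb{Z}$ is $\mathcal{I}$-positive if $X\notin\mathcal{I}$. A colouring $c:[\mathbb{Z}]^2\to 2$ is $\mathbb{Z}$-invariant if $c(\{x,y\})=c(\{x+z,y+z\})$ for all distinct $x,y\in\mathbb{Z}$ and all $z\in\mathbb{Z}$. A set $Y$ is $c$-homogeneous if $c$ is constant on $[Y]^2$. *)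

(* Defs.v *)
From mathcomp Require Import all_boot all_order all_algebra.
From mathcomp Require Import all_classical.

Set Implicit Arguments.
Unset Strict Implicit.
Unset Printing Implicit Defensive.

Import Order.TTheory GRing.Theory Num.Theory.

Local Open Scope classical_set_scope.
Local Open Scope card_scope.
Local Open Scope ring_scope.

(* The common difference [d] is required to be positive, so that a progression
   of length [n] has [n] distinct terms. *)
Definition contains_AP (A : set int) (n : nat) : Prop :=
  exists a d : int, 0 < d /\ forall i : nat, (i < n)%N -> A (a + d *+ i).

Definition vdW : set (set int) :=
  [set A | ~ (forall n : nat, contains_AP A n)].

Definition translate (g : int) (A : set int) : set int := [set g + x | x in A].

Definition thin (k : nat) (A : set int) : Prop :=
  forall g : int, g != 0 -> (translate g A `&` A) #<= `I_k.

Definition thin_ideal (k : nat) : set (set int) :=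
  [set A | exists (n : nat) (T : 'I_n -> set int),
     (forall i, thin k (T i)) /\ A `<=` \bigcup_i T i].

Definition positive (I : set (set int)) (X : set int) : Prop := ~ I X.

(* A colouring of the two-element subsets of the integers is a function on all
   of [set int] of which only the values at [[set x; y]] with [x != y] are ever
   used; the other values are junk. *)
Definition colouring := set int -> bool.

Definition invariant_colouring (c : colouring) : Prop :=
  forall x y z : int, x != y -> c [set x; y] = c [set x + z; y + z].

Definition homogeneous (c : colouring) (Y : set int) : Prop :=
  exists b : bool,
    forall x y : int, Y x -> Y y -> x != y -> c [set x; y] = b.

(* Main.v *)
Require Import Defs.
From mathcomp Require Import all_boot all_order all_algebra.
From mathcomp Require Import all_classical.
From mathcomp Require Import zify.

Local Open Scope classical_set_scope.

(** For (1) take [X] to be all of [int] and colour a pair by the parity of the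
    2-adic valuation of its difference: the differences [d] and [2 d] in a
    three-term progression get different colours.

    For (2) take the grid of all [p n + q m] with [p n = 5^(2n)] and
    [q m = 5^(2m+1)], and give a pair colour [true] iff its difference is that of
    two points in the same row [n].  By uniqueness of base 5 expansions, a sum of
    two grid points determines the two rows and the two columns involved.  A
    homogeneous subset lies in one row or meets each row at most once, and either
    way it is 1-thin.  The grid is not a finite union of thin sets: among finitely
    many rows, two carry the same colour class in unboundedly many columns, so the
    difference of these rows is realised too often. *)

(** A pair carries no order, so either ordering may witness [P]; the choice becomes irrelevant once
    [P] is closed under negation. *)
Definition difference_colouring (P : int -> Prop) : colouring :=
  fun S => `[< exists x y : int, [/\ S x, S y, x <> y & P (x - y)%R] >].

Lemma difference_colouring_invariant (P : int -> Prop) :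
  invariant_colouring (difference_colouring P).
Proof.
have shift (x y z u : int) : ([set x; y] u <-> [set x + z; y + z] (u + z))%R.
  by split=> -[] /= E; [left|right|left|right]; rewrite /=; lia.
move=> x y z _; apply: asbool_equiv_eq; split=> -[u [v [Su Sv uv Puv]]].
  exists (u + z)%R, (v + z)%R; split.
  - exact: (shift _ _ _ _).1.
  - exact: (shift _ _ _ _).1.
  - lia.
  - by have -> : (u + z - (v + z) = u - v)%R by lia.
exists (u - z)%R, (v - z)%R; split; [| |lia|].
- by apply: (shift _ _ z _).2; have -> : (u - z + z = u)%R by lia.
- by apply: (shift _ _ z _).2; have -> : (v - z + z = v)%R by lia.
- by have -> : (u - z - (v - z) = u - v)%R by lia.
Qed.

Lemma difference_colouringE (P : int -> Prop) (x y : int) :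
  (forall g, P g -> P (- g)%R) -> x <> y ->
  difference_colouring P [set x; y] = `[< P (x - y)%R >].
Proof.
move=> PN xy; apply: asbool_equiv_eq; split=> [|Pxy].
  move=> [u [v [[] /= -> [] /= -> //]]] _ /PN.
  by rewrite GRing.opprB.
by exists x, y; split=> //=; [left|right].
Qed.

(** Reduction modulo [B] recovers the lowest digit; cancelling it and dividing by [B] leaves one
    digit fewer. *)
Lemma sum_digits_inj (B N : nat) (f g : nat -> nat) :
  (forall i, f i < B) -> (forall i, g i < B) ->
  \sum_(i < N) f i * B ^ i = \sum_(i < N) g i * B ^ i ->
  forall i, i < N -> f i = g i.
Proof.
elim: N f g => // N IHN f g ltf ltg.
have shift (h : nat -> nat) : \sum_(i < N.+1) h i * B ^ i
    = h 0 + (\sum_(i < N) h i.+1 * B ^ i) * B.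
  rewrite big_ord_recl expn0 muln1 big_distrl /=; congr (_ + _).
  by apply: eq_bigr => i _; rewrite expnSr mulnA.
rewrite !shift => E.
have B_gt0 : 0 < B by apply: leq_ltn_trans (ltf 0).
have E0 : f 0 = g 0.
  by have := congr1 (modn^~ B) E; rewrite !(addnC _ (_ * B)) !modnMDl !modn_small.
have IH : \sum_(i < N) f i.+1 * B ^ i = \sum_(i < N) g i.+1 * B ^ i.
  by move/eqP: E; rewrite E0 eqn_add2l eqn_pmul2r// => /eqP.
case=> // i; rewrite ltnS => iN.
by apply: (IHN (fun i => f i.+1) (fun i => g i.+1)) IH i iN => j.
Qed.

(** The coefficient of [B ^ i] is the multiplicity of [i], and the size bound makes it a legitimate
    digit: no carries occur. *)
Lemma sum_expn_perm (B : nat) (s t : seq nat) :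
  size s < B -> size t < B ->
  \sum_(i <- s) B ^ i = \sum_(i <- t) B ^ i -> perm_eq s t.
Proof.
move=> ss st E; pose N := (\max_(i <- s ++ t) i).+1.
have ltN i : i \in s ++ t -> i < N.
  by move=> ist; rewrite ltnS; apply: (@leq_bigmax_seq _ _ predT id).
have expand (r : seq nat) : {subset r <= s ++ t} ->
    \sum_(i <- r) B ^ i = \sum_(i < N) count_mem (val i) r * B ^ i.
  elim: r => [|j r IHr] sub; first by rewrite big_nil big1.
  rewrite big_cons IHr; last by move=> i ir; rewrite sub// inE ir orbT.
  have jN : j < N by apply/ltN/sub/mem_head.
  under [RHS]eq_bigr do rewrite /= mulnDl.
  rewrite big_split /=; congr (_ + _).
  rewrite (bigD1 (Ordinal jN))//= eqxx mul1n big1 ?addn0// => i ij.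
  by rewrite (_ : j == i = false)//; apply: contra_neqF ij => /eqP ji; apply: val_inj.
move: E; rewrite !expand; first last.
- by move=> i; rewrite mem_cat => ->.
- by move=> i; rewrite mem_cat => ->; rewrite orbT.
move=> /(@sum_digits_inj _ _ (fun i => count_mem i s) (fun i => count_mem i t)) E.
apply/allP => i /ltN /E /= ->; rewrite ?eqxx// => j.
  exact: leq_ltn_trans (count_size _ _) ss.
exact: leq_ltn_trans (count_size _ _) st.
Qed.

Definition grid (n m : nat) : nat := 5 ^ n.*2 + 5 ^ m.*2.+1.

Lemma perm_eq_pair (T : eqType) (a b c d : T) :
  perm_eq [:: a; b] [:: c; d] -> a = c /\ b = d \/ a = d /\ b = c.
Proof.
have same x y z : perm_eq [:: x; y] [:: x; z] -> y = z :> T.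
  by rewrite perm_cons => /(@perm_small_eq _ [:: y] [:: z] isT)[].
move=> p; have := perm_mem p a; rewrite !inE eqxx /= => /esym/orP[]/eqP E; subst.
  by left; split=> //; apply: same p.
right; split=> //; apply: (same d); apply: perm_trans p _.
by rewrite (perm_catC [:: c] [:: d]).
Qed.

(** Each side is a sum of four powers, whence the base 5. Even exponents encode rows and odd ones
    columns, so filtering by parity separates them. *)
Lemma grid_sum_inj (a b c d a' b' c' d' : nat) :
  grid a b + grid c d = grid a' b' + grid c' d' ->
  (a = a' /\ c = c' \/ a = c' /\ c = a') /\
  (b = b' /\ d = d' \/ b = d' /\ d = b').
Proof.
move=> E; have := @sum_expn_perm 5 [:: a.*2; b.*2.+1; c.*2; d.*2.+1]
  [:: a'.*2; b'.*2.+1; c'.*2; d'.*2.+1] isT isT.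
rewrite !big_cons !big_nil !addn0 !addnA -/(grid _ _) -addnA E addnA.
move=> /(_ erefl) p.
split; apply: perm_eq_pair.
- have := perm_map half (perm_filter (predC odd) p).
  by rewrite /= !odd_double /= !doubleK.
- have := perm_map half (perm_filter odd p).
  by rewrite /= !odd_double /= !uphalf_double.
Qed.

Definition grid_set : set int := [set x | exists n m, x = Posz (grid n m)].

Definition row_difference (g : int) : Prop :=
  exists n m m', m <> m' /\ (g = Posz (grid n m) - Posz (grid n m'))%R.

Lemma row_differenceN (g : int) : row_difference g -> row_difference (- g)%R.
Proof.
by move=> [n [m [m' [mm' ->]]]]; exists n, m', m; split; [exact/nesym|lia].
Qed.

(** Moving the negative terms across turns a coincidence of differences into an equation between
    sums of two grid points. *)
Lemma row_differenceP (n m n' m' : nat) : grid n m <> grid n' m' ->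
  row_difference (Posz (grid n m) - Posz (grid n' m'))%R <-> n = n'.
Proof.
move=> neq; split=> [[r [j [j' [_ E]]]]|nn'].
  have /grid_sum_inj[] : grid n m + grid r j' = grid r j + grid n' m' by lia.
  lia.
by subst n'; exists n, m, m'; split=> // mm'; apply: neq; rewrite mm'.
Qed.

(** Two common points of [A] and its translate by [g] end two pairs of difference [g]; as [g] is
    nonzero, the Sidon condition identifies them. *)
Lemma sidon_thin (k : nat) (A : set int) : (0 < k)%N ->
  (forall x y u v, A x -> A y -> A u -> A v ->
     (x + v = u + y)%R -> x = u \/ x = y) ->
  thin k A.
Proof.
move=> k_gt0 sidon g g0.
have [->|/set0P[z [[y Ay yz] Az]]] := eqVneq (translate g A `&` A) set0.
  exact: card_ge0.
have sub : translate g A `&` A `<=` [set z].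
  move=> u [[v Av vu] Au] /=.
  case: (sidon z y u v Az Ay Au Av); lia.
apply: card_le_trans (subset_card_le sub) _.
by rewrite (card_le_eql card_set1) card_le_II.
Qed.

Lemma homogeneous_grid_thin (k : nat) (Y : set int) : (0 < k)%N ->
  Y `<=` grid_set -> homogeneous (difference_colouring row_difference) Y ->
  thin k Y.
Proof.
move=> k_gt0 YX [b hb]; apply: sidon_thin => // x y u v Yx Yy Yu Yv.
have rows n m n' m' : Y (Posz (grid n m)) -> Y (Posz (grid n' m')) ->
    grid n m <> grid n' m' -> `[< n = n' >] = b.
  move=> Y1 Y2 neq; rewrite -(hb _ _ Y1 Y2); last by apply/eqP; lia.
  rewrite difference_colouringE//; [|exact: row_differenceN|lia].
  exact/esym/asbool_equiv_eq/row_differenceP.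
move: (YX _ Yx) (YX _ Yy) (YX _ Yu) (YX _ Yv).
move=> [n1 [m1 ?]] [s1 [t1 ?]] [n2 [m2 ?]] [s2 [t2 ?]] E; subst.
have [Er Ec] : _ := @grid_sum_inj n1 m1 s2 t2 n2 m2 s1 t1 ltac:(lia).
have [->|xu] := pselect (grid n1 m1 = grid n2 m2); first by left.
have [->|xy] := pselect (grid n1 m1 = grid s1 t1); first by right.
(* By [Er], [x] shares its row with [u] or with [y]; homogeneity then gives both, and [Ec] makes [x]
   equal to one of them. *)
have := rows _ _ _ _ Yx Yu xu; have <- := rows _ _ _ _ Yx Yy xy.
case: (asboolP (n1 = n2)); case: (asboolP (n1 = s1)) => // *; subst.
  by case: Ec => -[? _]; subst.
by case: Er => -[? _]; subst.
Qed.

Lemma pigeonhole_fibre (N k : nat) (F : finType) (h : 'I_N -> F) :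
  k * #|F| < N -> exists y, k < #|[pred i | h i == y]|.
Proof.
move=> ltN; apply: contrapT => /forallNP small; move: ltN; apply/negP.
rewrite -leqNgt -[N in N <= _]card_ord -sum1_card (partition_big h predT)//=.
rewrite mulnC -sum_nat_const; apply: leq_sum => y _.
by rewrite sum1_card leqNgt; apply/negP/small.
Qed.

Lemma grid_set_positive (k : nat) : positive (thin_ideal k) grid_set.
Proof.
move=> [n [T [thinT cover]]].
have /choice[chi chiP] (ab : nat * nat) :
    exists i : 'I_n, T i (Posz (grid ab.1 ab.2)).
  have /cover[i _ Ti] : grid_set (Posz (grid ab.1 ab.2)) by exists ab.1, ab.2.
  by exists i.
(* In column [b], the first [n.+1] rows meet only [n] pieces, so two of them share a piece. *)
have /choice[h hP] (b : nat) : exists r : 'I_n.+1 * 'I_n.+1,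
    r.1 != r.2 /\ chi (val r.1, b) = chi (val r.2, b).
  have /injectivePn[a [a' neq E]] :
      ~~ injectiveb (fun a : 'I_n.+1 => chi (val a, b)).
    by apply/negP => /injectiveP/leq_card; rewrite !card_ord ltnn.
  by exists (a, a').
pose F := (('I_n.+1 * 'I_n.+1) * 'I_n)%type.
(* Enough columns for more than [k] of them to agree on both the pair of rows and the piece. *)
pose N := (k * #|{: F}|).+1.
have [[[a a'] i] big] := @pigeonhole_fibre N k F
  (fun b => (h b, chi (val (h b).1, val b))) (ltnSn _).
set E := [pred b | _] in big.
have EP (b : 'I_N) : b \in E ->
    [/\ a != a', T i (Posz (grid a b)) & T i (Posz (grid a' b))].
  rewrite inE => /eqP[]; case: (hP b) => neq eqchi hb; rewrite hb /= in neq eqchi *.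
  move=> <-; split=> //.
  by rewrite eqchi; apply: (chiP (val a', val b)).
have [b0 b0E] : exists b, b \in E by apply/card_gt0P/(leq_ltn_trans _ big).
have [neq _ _] := EP _ b0E.
(* The column terms cancel, so rows [a] and [a'] differ by this same [g] in every column. *)
pose g := (Posz (grid a 0) - Posz (grid a' 0))%R.
have g0 : g != 0%R.
  apply: contra neq => /eqP g0; apply/eqP/val_inj.
  (* An equality of single points is doubled to fit [grid_sum_inj]. *)
  have /grid_sum_inj[] : grid a 0 + grid a 0 = grid a' 0 + grid a' 0.
    by rewrite /g in g0; lia.
  by rewrite /=; lia.
have := thinT i g g0.
(* [b0] is only a default value: the indices used are at most [k], below the size of [E]. *)
pose col (j : nat) : nat := nth b0 (enum E) j.
pose pt (j : nat) : int := Posz (grid a (col j)).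
have sub : pt @` `I_k.+1 `<=` translate g (T i) `&` T i.
  move=> _ [j /= jk <-].
  have /EP[_ Ta Ta'] : nth b0 (enum E) j \in E.
    by rewrite -mem_enum mem_nth// -cardE (leq_trans jk).
  split=> //; exists (Posz (grid a' (col j))) => //.
  by rewrite /pt /g /grid; lia.
have inj : {in `I_k.+1 &, injective pt}.
  move=> j j'; rewrite !inE /= => jk j'k [Ejj'].
  have /grid_sum_inj[_ Ec] :
    grid a (col j) + grid a (col j) = grid a (col j') + grid a (col j').
    by rewrite Ejj'.
  have : nth b0 (enum E) j = nth b0 (enum E) j'.
    by apply: val_inj; case: Ec => -[].
  move/eqP; rewrite nth_uniq ?enum_uniq -?cardE ?(leq_trans jk)//.
    by move/eqP.
  exact: leq_trans j'k big.
move=> /(card_le_trans (subset_card_le sub)).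
by rewrite (card_le_eql (inj_card_eq inj)) // card_le_II ltnn.
Qed.

Definition odd_valuation (g : int) : Prop := odd (logn 2 `|g|%N).

Lemma homogeneous_valuation_vdW (Y : set int) :
  homogeneous (difference_colouring odd_valuation) Y -> vdW Y.
Proof.
move=> [b hb] /(_ 3)[a [d [d0 AP]]].
have val (i j : nat) : i < 3 -> j < 3 -> (a + d *+ i <> a + d *+ j)%R ->
    odd (logn 2 `|(a + d *+ i - (a + d *+ j))%R|%N) = b.
  move=> /AP Yi /AP Yj neq; rewrite -(hb _ _ Yi Yj); last exact/eqP.
  rewrite difference_colouringE//; first by rewrite asboolb.
  by move=> g; rewrite /odd_valuation abszN.
have := val 2 0 isT isT; have := val 1 0 isT isT.
have -> : (`|(a + d *+ 2 - (a + d *+ 0))%R| = 2 * `|d|)%N by lia.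
have -> : (`|(a + d *+ 1 - (a + d *+ 0))%R| = `|d|)%N by lia.
(* Doubling [d] raises its valuation by one and so flips the parity. *)
rewrite (@lognM 2 2)//; last lia.
rewrite (@logn_prime 2 2)// add1n /= => /(_ ltac:(lia)) <- /(_ ltac:(lia)).
by case: odd.
Qed.

Theorem theorem3p6 :
  (exists (X : set int) (c : colouring),
     [/\ positive vdW X,
         invariant_colouring c &
         forall Y : set int, Y `<=` X -> homogeneous c Y -> vdW Y])
  /\
  (forall k : nat, (1 <= k)%N ->
     exists (X : set int) (c : colouring),
       [/\ positive (thin_ideal k) X,
           invariant_colouring c &
           forall Y : set int, Y `<=` X -> homogeneous c Y -> thin_ideal k Y]).
Proof.
split=> [|k k_gt0].
  exists setT, (difference_colouring odd_valuation); split.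
  - by move=> /=; apply => n; exists 0%R, 1%R.
  - exact: difference_colouring_invariant.
  - by move=> Y _; apply: homogeneous_valuation_vdW.
exists grid_set, (difference_colouring row_difference); split.
- exact: grid_set_positive.
- exact: difference_colouring_invariant.
- move=> Y YX homY; exists 1, (fun=> Y); split.
    by move=> _; apply: homogeneous_grid_thin.
  by move=> y Yy; exists ord0.
Qed.
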